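(* Let $\kappa$ be a singular (uncountable) cardinal with $2^{<\kappa}=\kappa$, and let $X$ be a nonempty regular Hausdorff space of weight at most $\kappa$ such that every open subset of $X$ is a union of at most $\operatorname{cof}(\kappa)$-many closed sets (i.e. $\kappa\text{-}\boldsymbol{\Sigma}^0_1(X)\subseteq\operatorname{cof}(\kappa)^+\text{-}\boldsymbol{\Sigma}^0_2(X)$). Then for every $\alpha<\kappa^+$, $$\operatorname{ord}_{\kappa^+}(X)\le 1+\alpha\quad\Longleftrightarrow\quad \operatorname{ord}_{\kappa}(X)\le 1+2\cdot\alpha.$$ In particular, if one of $\operatorname{ord}_{\kappa^+}(X)$ or $\operatorname{ord}_{\kappa}(X)$ is a limit ordinal $\alpha$, then $\operatorname{ord}_{\kappa^+}(X)=\operatorname{ord}_{\kappa}(X)=\alpha$.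
   Context: For a topological space $X$ and an ordinal $\gamma>\omega$, define by recursion on ordinals $\alpha\ge 1$: $\gamma\text{-}\boldsymbol{\Sigma}^0_1(X)$ is the family of open sets; for $\alpha>1$, $\gamma\text{-}\boldsymbol{\Sigma}^0_\alpha(X)$ is the family of all unions $\bigcup_{\xi<\delta}A_\xi$ with $\delta<\gamma$ and each $A_\xi\in\bigcup_{1\le\beta<\alpha}\gamma\text{-}\boldsymbol{\Pi}^0_\beta(X)$; $\gamma\text{-}\boldsymbol{\Pi}^0_\alpha(X)$ is the family of complements of sets in $\gamma\text{-}\boldsymbol{\Sigma}^0_\alpha(X)$. $\gamma\text{-}\mathbf{Bor}(X)$ is the smallest family of subsets of $X$ containing the open sets and closed under complements and well-ordered unions of length less than $\gamma$. The order is $\operatorname{ord}_\gamma(X)=\min\{\alpha\in\mathrm{Ord}\mid\gamma\text{-}\boldsymbol{\Sigma}^0_\alpha(X)=\gamma\text{-}\mathbf{Bor}(X)\}$. Here $2\cdot\alpha$ is ordinal multiplication ($\alpha$ copies of $2$, so $2\cdot(\lambda+n)=\lambda+2n$ for $\lambda$ zero or limit and $n<\omega$). *)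

(* Defs.v *)
From mathcomp Require Import all_boot.
From mathcomp Require Import boolp classical_sets functions cardinality.
From mathcomp Require Import topology.

Set Implicit Arguments.
Unset Strict Implicit.
Unset Printing Implicit Defensive.

Local Open Scope classical_set_scope.
Local Open Scope card_scope.

(* Ordinals are represented by well-ordered types. Two of them denote the same
   ordinal when they are isomorphic ([oeq]), and the elements of [a] stand for
   the ordinals smaller than [a] ([oseg] gives the ordinal of an element). *)

Record Ord := MkOrd {
  ocar :> Type;
  orel : ocar -> ocar -> Prop;
  orel_trans : forall x y z, orel x y -> orel y z -> orel x z;
  orel_total : forall x y, orel x y \/ x = y \/ orel y x;
  orel_wf : well_founded orel
}.

Definition oeq (a b : Ord) : Prop :=
  exists2 f : a -> b, bijective f & forall x y, orel x y -> orel (f x) (f y).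

Section InitialSegment.
Variables (a : Ord) (x : a).

Definition oseg_rel (y z : {y : a | orel y x}) : Prop :=
  orel (proj1_sig y) (proj1_sig z).

Lemma oseg_trans y z t : oseg_rel y z -> oseg_rel z t -> oseg_rel y t.
Proof. exact: orel_trans. Qed.

Lemma oseg_total y z : oseg_rel y z \/ y = z \/ oseg_rel z y.
Proof.
case: y z => [y yx] [z zx]; rewrite /oseg_rel /=.
case: (orel_total y z) => [|[yz|]]; [by left| |by right; right].
by right; left; subst z; rewrite (Prop_irrelevance yx zx).
Qed.

Lemma oseg_wf : well_founded oseg_rel.
Proof.
case=> y; elim/(well_founded_ind (@orel_wf a)): y => y IH yx.
by constructor=> -[z zx] /= /IH; apply.
Qed.

Definition oseg : Ord := MkOrd oseg_trans oseg_total oseg_wf.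
End InitialSegment.

Definition olt (a b : Ord) : Prop := exists x : b, oeq a (oseg x).
Definition ole (a b : Ord) : Prop := olt a b \/ oeq a b.

Section Zero.
Let r (x y : void) : Prop := False.
Lemma ozero_trans x y z : r x y -> r y z -> r x z. Proof. by case: x. Qed.
Lemma ozero_total x y : r x y \/ x = y \/ r y x. Proof. by case: x. Qed.
Lemma ozero_wf : well_founded r. Proof. by case. Qed.
Definition ozero : Ord := MkOrd ozero_trans ozero_total ozero_wf.
End Zero.

Section One.
Let r (x y : unit) : Prop := False.
Lemma oone_trans x y z : r x y -> r y z -> r x z. Proof. by []. Qed.
Lemma oone_total x y : r x y \/ x = y \/ r y x.
Proof. by case: x; case: y; right; left. Qed.
Lemma oone_wf : well_founded r. Proof. by move=> x; constructor. Qed.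
Definition oone : Ord := MkOrd oone_trans oone_total oone_wf.
End One.

Section Sum.
Variables a b : Ord.

Definition oadd_rel (u v : a + b) : Prop :=
  match u, v with
  | inl x, inl y => orel x y
  | inl _, inr _ => True
  | inr _, inl _ => False
  | inr x, inr y => orel x y
  end.

Lemma oadd_trans u v w : oadd_rel u v -> oadd_rel v w -> oadd_rel u w.
Proof. by case: u v w => [x|x] [y|y] [z|z] //=; apply: orel_trans. Qed.

Lemma oadd_total u v : oadd_rel u v \/ u = v \/ oadd_rel v u.
Proof.
case: u v => [x|x] [y|y] /=; [|by left|by right; right|];
by case: (orel_total x y) => [|[->|]]; [left|right; left|right; right].
Qed.

Lemma oadd_wf : well_founded oadd_rel.
Proof.
have accl x : Acc oadd_rel (inl x).
  elim/(well_founded_ind (@orel_wf a)): x => x IH.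
  by constructor; case=> [y /IH|].
case=> [x|x]; first exact: accl.
elim/(well_founded_ind (@orel_wf b)): x => x IH.
constructor; case=> [y _|y yx]; [exact: accl|exact: IH].
Qed.

Definition oadd : Ord := MkOrd oadd_trans oadd_total oadd_wf.
End Sum.

(* [omul a b] is the ordinal product a.b, that is, [b] copies of [a]. *)
Section Product.
Variables a b : Ord.

Definition omul_rel (u v : a * b) : Prop :=
  orel u.2 v.2 \/ (u.2 = v.2 /\ orel u.1 v.1).

Lemma omul_trans u v w : omul_rel u v -> omul_rel v w -> omul_rel u w.
Proof.
case: u v w => [x y] [x' y'] [x2 y2]; rewrite /omul_rel /=.
case=> [yy'|[-> xx']] [y'y2|[<- x'x2]]; [left|left|left|right] => //.
- exact: orel_trans yy' y'y2.
- by split=> //; exact: orel_trans xx' x'x2.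
Qed.

Lemma omul_total u v : omul_rel u v \/ u = v \/ omul_rel v u.
Proof.
case: u v => [x y] [x' y']; rewrite /omul_rel /=.
case: (orel_total y y') => [|[->|]]; [by left; left| |by right; right; left].
case: (orel_total x x') => [|[->|]]; [by left; right|by right; left|].
by right; right; right.
Qed.

Lemma omul_wf : well_founded omul_rel.
Proof.
case=> x y; elim/(well_founded_ind (@orel_wf b)): y x => y IHy x.
elim/(well_founded_ind (@orel_wf a)): x => x IHx.
by constructor=> -[x' y'] [/= /IHy|[/= -> /IHx]].
Qed.

Definition omul : Ord := MkOrd omul_trans omul_total omul_wf.
End Product.

Definition otwo : Ord := oadd oone oone.

Definition olimit (a : Ord) : Prop :=
  inhabited a /\ forall x : a, exists y, orel x y.

(* The least ordinal satisfying [P], with dummy value 0 if there is none. *)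
Definition oleast (P : Ord -> Prop) (a : Ord) : Prop :=
  P a /\ forall b, P b -> ole a b.

Definition omin (P : Ord -> Prop) : Ord :=
  match pselect (exists a, oleast P a) with
  | left h => proj1_sig (cid h)
  | right _ => ozero
  end.

(* Cardinals are initial ordinals. *)
Definition is_cardinal (k : Ord) : Prop :=
  forall x : k, ~ ([set: k] #<= [set: oseg x]).

Definition csucc (k : Ord) : Ord :=
  omin (fun a => ~ ([set: a] #<= [set: k])).

Definition cof (k : Ord) : Ord :=
  omin (fun l => exists f : l -> k,
    forall x : k, exists i, orel x (f i) \/ x = f i).

Definition singular (k : Ord) : Prop :=
  [/\ is_cardinal k, ~ countable [set: k] & olt (cof k) k].

(* The cardinal 2^{<k}, the supremum of the cardinals 2^l with l < k. *)
Definition pow2_lt (k : Ord) : Ord :=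
  omin (fun c => forall x : k, [set: set (oseg x)] #<= [set: c]).

Definition weight (X : topologicalType) : Ord :=
  omin (fun c => exists2 B : set (set X), basis B & B #<= [set: c]).

Section GammaBorel.
Variables (g : Ord) (X : topologicalType).

(* Recursion on the level, written as an inductive predicate: the level [b i]
   witnesses that [A i], being the complement of a Sigma set of level [b i],
   is a Pi set of level [b i]. No set has level 0. *)
Inductive Sigma : Ord -> set (set X) :=
| Sigma_open (a : Ord) (U : set X) : oeq a oone -> open U -> Sigma a U
| Sigma_bigcup (a d : Ord) (A : d -> set X) (b : d -> Ord) :
    olt oone a -> olt d g ->
    (forall i, ole oone (b i)) -> (forall i, olt (b i) a) ->
    (forall i, Sigma (b i) (~` A i)) ->
    Sigma a (\bigcup_i A i).

Definition gamma_algebra (F : set (set X)) : Prop :=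
  (forall A, F A -> F (~` A)) /\
  (forall (d : Ord) (A : d -> set X),
     olt d g -> (forall i, F (A i)) -> F (\bigcup_i A i)).

Definition Bor : set (set X) := smallest gamma_algebra open.

Definition borel_ord : Ord :=
  omin (fun a => ole oone a /\ Sigma a = Bor).
End GammaBorel.

Arguments Sigma g X a _ : clear implicits.
Arguments Bor g X : clear implicits.
Arguments borel_ord g X : clear implicits.

(* Main.v *)
Require Import Defs.
From mathcomp Require Import all_boot.
From mathcomp Require Import boolp classical_sets functions cardinality.
From mathcomp Require Import wochoice.
From mathcomp Require Import topology.

Local Open Scope classical_set_scope.

Set Implicit Arguments.
Unset Strict Implicit.
Unset Printing Implicit Defensive.

(** Let [k] be singular with 2^{<k} = k. By Koenig's argument [k] is a strong
    limit ([small_set]), so fewer than [k] many choices, each among a bounded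
    number less than [k] of possibilities, can be made in fewer than [k] ways.

    Write S_c and K_c for the classes Sigma_c of the hierarchies at k^+ and at
    [k], and Pi_c for the complements. The hierarchies proceed at different
    speeds, S_{1+a} = K_{1+2.a} for all a < k^+ ([Sigma_csucc_double]), by
    induction on [a]. Two facts account for the factor 2.

    - The classes K_{1+2.x+1} are closed under complements
      ([Sigma_succ_compl]). Indeed every set of K_{1+2.x} = S_{1+x} is a union
      of a number of Pi_{1+2.x} sets that is less than [k] and does not depend
      on the set. By distributivity an intersection of fewer than [k] many such
      sets is a union, over fewer than [k] many choice functions, of
      intersections of fewer than [k] many Pi_{1+2.x} sets, and these
      intersections are Pi_{1+2.x} again, because S_{1+x} is closed under unions
      of length [k]. This is where the assumption on open sets starts the
      induction.
    - A union of [k] many sets of lower class can be cut into fewer than [k]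
      many groups, each of fewer than [k] many sets of bounded class: [k] is a
      union of cof(k) many shorter segments, and as a < k^+ has a cofinal subset
      of size less than [k] ([small_cofinal]), so many bounds for the class
      suffice. Each group lies in some K_{1+2.x+1}, hence is also a Pi set at
      this level, and the whole is a union of fewer than [k] many such sets.

    Since [k] is singular, the two algebras of Borel sets coincide
    ([Bor_csucc]), so S_{1+a} exhausts them if and only if K_{1+2.a} does; this
    is the equivalence. Both hierarchies stop at k^+ at the latest
    ([Sigma_csucc]), and 1 + a = 2.a = a for limits [a] ([limit_1add],
    [limit_double]); the claim on limits follows. *)

(** * Comparing well-orders *)

Definition smono (a b : Ord) (f : a -> b) : Prop :=
  forall x y, orel x y -> orel (f x) (f y).

Lemma orel_irr (a : Ord) (x : a) : ~ orel x x.
Proof.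
by elim/(well_founded_ind (@orel_wf a)): x => x IH xx; exact: (IH x).
Qed.

Lemma orel_asym (a : Ord) (x y : a) : orel x y -> ~ orel y x.
Proof. by move=> xy yx; apply: (@orel_irr _ x); exact: orel_trans yx. Qed.

Lemma orel_least (a : Ord) (P : a -> Prop) : (exists x, P x) ->
  exists2 x, P x & forall y, orel y x -> ~ P y.
Proof.
move=> [x Px]; apply: contrapT => noleast; move: x Px.
suff nP y : ~ P y by move=> x /nP.
elim/(well_founded_ind (@orel_wf a)): y => y IH Py.
by apply: noleast; exists y => // z /IH.
Qed.

Lemma smono_inj (a b : Ord) (f : a -> b) : smono f -> injective f.
Proof.
move=> fm x y fxy; case: (orel_total x y) => [/fm|[//|/fm]];
by rewrite fxy => /orel_irr.
Qed.

(** Iterating [f] from a point that it decreases would give an infinite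
    descent. *)
Lemma smono_ge (a : Ord) (f : a -> a) : smono f -> forall x, ~ orel (f x) x.
Proof.
move=> fm x; elim/(well_founded_ind (@orel_wf a)): x => x IH fxx.
exact: (IH _ fxx (fm _ _ fxx)).
Qed.

Lemma smono_surj_oeq (a b : Ord) (f : a -> b) :
  smono f -> (forall y, exists x, f x = y) -> oeq a b.
Proof.
move=> fm /choice[g fg]; exists f => //; exists g => // x.
exact: (smono_inj fm).
Qed.

Lemma oeq_smono (a b : Ord) : oeq a b ->
  exists f : a -> b, smono f /\ (forall y, exists x, f x = y).
Proof. by case=> f [g fg gf] fm; exists f; split=> // y; exists (g y). Qed.

Lemma oeq_refl (a : Ord) : oeq a a.
Proof. by exists id => //; exists id. Qed.

Lemma oeq_sym (a b : Ord) : oeq a b -> oeq b a.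
Proof.
case=> f [g fg gf] fm; exists g; first by exists f.
move=> x y xy; case: (orel_total (g x) (g y)) => [//|[gxy|/fm]].
  by move: xy; rewrite -(gf x) gxy gf => /orel_irr.
by rewrite !gf => /(orel_asym xy).
Qed.

Lemma oeq_trans (a b c : Ord) : oeq a b -> oeq b c -> oeq a c.
Proof.
move=> /oeq_smono[f [fm fs]] /oeq_smono[g [gm gs]].
apply: (@smono_surj_oeq _ _ (g \o f)); first by move=> x y /fm/gm.
by move=> z; have [y <-] := gs z; have [x <-] := fs y; exists x.
Qed.

Lemma oseg_oeq (a : Ord) (x : a) (y : oseg x) :
  oeq (oseg (proj1_sig y)) (oseg y).
Proof.
pose f (z : oseg (proj1_sig y)) : oseg y :=
  let: exist z zy := z in
  exist _ (exist _ z (orel_trans zy (proj2_sig y))) zy.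
apply: (@smono_surj_oeq _ _ f); first by case=> [? ?] [? ?].
case=> -[z zx] zy; exists (exist _ z zy) => /=.
by apply: eq_exist; exact: eq_exist.
Qed.

Lemma oseg_oeq_image (a b : Ord) (f : a -> b) (x : a) : smono f ->
  (forall y, exists x, f x = y) -> oeq (oseg x) (oseg (f x)).
Proof.
move=> fm fs.
pose g (z : oseg x) : oseg (f x) :=
  exist _ (f (proj1_sig z)) (fm _ _ (proj2_sig z)).
apply: (@smono_surj_oeq _ _ g); first by case=> [? ?] [? ?]; exact: fm.
case=> z zfx; have [y fy] := fs z.
have yx : orel y x.
  case: (orel_total y x) => [//|[yx|/fm]].
    by move: zfx; rewrite -fy yx => /orel_irr.
  by rewrite fy => /(orel_asym zfx).
by exists (exist _ y yx); exact: eq_exist.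
Qed.

Lemma olt_oseg (a : Ord) (x : a) : olt (oseg x) a.
Proof. by exists x; exact: oeq_refl. Qed.

Lemma olt_osegP (a b : Ord) (x : a) :
  olt b (oseg x) <-> exists2 y, orel y x & oeq b (oseg y).
Proof.
split=> [[y by_]|[y yx by_]].
  exists (proj1_sig y); first exact: (proj2_sig y).
  exact: oeq_trans by_ (oeq_sym (oseg_oeq y)).
by exists (exist _ y yx); exact: oeq_trans by_ (oseg_oeq (exist _ y yx)).
Qed.

Lemma oseg_lt (a : Ord) (x y : a) : orel x y -> olt (oseg x) (oseg y).
Proof. by move=> xy; apply/olt_osegP; exists x => //; exact: oeq_refl. Qed.

Lemma oeq_ltl (a b c : Ord) : oeq a b -> olt b c -> olt a c.
Proof. by move=> ab [x bx]; exists x; exact: oeq_trans bx. Qed.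

Lemma olt_eqr (a b c : Ord) : olt a b -> oeq b c -> olt a c.
Proof.
move=> [x ax] /oeq_smono[f [fm fs]]; exists (f x).
exact: oeq_trans ax (oseg_oeq_image x fm fs).
Qed.

Lemma olt_trans (a b c : Ord) : olt a b -> olt b c -> olt a c.
Proof.
move=> ab [y bY]; have /olt_osegP[x _ ax] := olt_eqr ab bY.
by exists x.
Qed.

Lemma olt_irr (a : Ord) : ~ olt a a.
Proof.
case=> x /oeq_smono[f [fm _]].
apply: (@smono_ge a (fun y => proj1_sig (f y)) _ x).
  by move=> y z /fm.
exact: (proj2_sig (f x)).
Qed.

Lemma olt_wf : well_founded olt.
Proof.
have accseg (a : Ord) (x : a) b : oeq b (oseg x) -> Acc olt b.
  elim/(well_founded_ind (@orel_wf a)): x b => x IH b bx.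
  constructor=> c cb; have /olt_osegP[y yx cy] := olt_eqr cb bx.
  exact: IH yx _ cy.
by move=> a; constructor=> b [x bx]; exact: accseg bx.
Qed.

Lemma ole_refl (a : Ord) : ole a a.
Proof. by right; exact: oeq_refl. Qed.

Lemma ole_lt_trans (a b c : Ord) : ole a b -> olt b c -> olt a c.
Proof. by case=> [/olt_trans|/oeq_ltl]; apply. Qed.

Lemma olt_le_trans (a b c : Ord) : olt a b -> ole b c -> olt a c.
Proof. by move=> ab [|]; [exact: olt_trans|exact: olt_eqr]. Qed.

Lemma ole_trans (a b c : Ord) : ole a b -> ole b c -> ole a c.
Proof.
move=> ab [bc|bc]; first by left; exact: ole_lt_trans bc.
case: ab => ab; first by left; exact: olt_eqr bc.
by right; exact: oeq_trans bc.
Qed.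

Lemma olt_nge (a b : Ord) : olt a b -> ~ ole b a.
Proof. by move=> ab ba; exact: (olt_irr (olt_le_trans ab ba)). Qed.

Lemma ole_antisym (a b : Ord) : ole a b -> ole b a -> oeq a b.
Proof. by case=> // ab /(olt_nge ab). Qed.

Lemma oseg_inj (a : Ord) (x y : a) : oeq (oseg x) (oseg y) -> x = y.
Proof.
move=> xy; case: (orel_total x y) => [/oseg_lt yx|[//|/oseg_lt yx]].
  by case: (olt_irr (olt_eqr yx (oeq_sym xy))).
by case: (olt_irr (olt_eqr yx xy)).
Qed.

Lemma oseg_lt_rel (a : Ord) (x y : a) : olt (oseg x) (oseg y) -> orel x y.
Proof. by move=> /olt_osegP[z zy /oseg_inj->]. Qed.

(** Matching each segment of [a] with the segment of [b] of the same type is an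
    increasing map with downward closed range, so its range is [b] or a
    segment of [b]. *)
Lemma segs_ole (a b : Ord) : (forall x : a, olt (oseg x) b) -> ole a b.
Proof.
move=> /choice[f fP].
have fm : smono f.
  move=> x y /oseg_lt xy; apply: oseg_lt_rel.
  apply: oeq_ltl (oeq_sym (fP x)) _; exact: olt_eqr xy (fP y).
have fdown y x : orel y (f x) -> exists x', f x' = y.
  move=> yfx; have := oeq_ltl (oeq_refl (oseg y)) (oseg_lt yfx).
  move=> /olt_eqr/(_ (oeq_sym (fP x)))/olt_osegP[x' _ yx'].
  exists x'; apply: oseg_inj; apply: oeq_trans (oeq_sym (fP x')) _.
  exact: oeq_sym.
have [fs|] := pselect (forall y, exists x, f x = y).
  by right; exact: smono_surj_oeq fm fs.
move=> /existsNP/orel_least[y nfy ymin]; left; exists y.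
have fy x : orel (f x) y.
  case: (orel_total (f x) y) => [//|[fxy|/fdown//]].
  by case: nfy; exists x.
apply: (@smono_surj_oeq _ _ (fun x => exist _ (f x) (fy x) : oseg y)).
  by move=> x x' /fm.
case=> z zy; have /contrapT[x fx] := ymin _ zy.
by exists x; exact: eq_exist.
Qed.

Lemma smono_ole (a b : Ord) (f : a -> b) : smono f -> ole a b.
Proof.
elim/(well_founded_ind olt_wf): a b f => a IH b f fm.
apply: segs_ole => x.
pose g (z : oseg x) : oseg (f x) :=
  exist _ (f (proj1_sig z)) (fm _ _ (proj2_sig z)).
have : ole (oseg x) (oseg (f x)).
  by apply: (IH _ (olt_oseg x) _ g) => -[? ?] [? ?]; exact: fm.
by move=> /ole_lt_trans; apply; exact: olt_oseg.
Qed.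

Lemma ole_smono (a b : Ord) : ole a b -> exists f : a -> b, smono f.
Proof.
case=> [[x]|]; move=> /oeq_smono[f [fm _]]; last by exists f.
by exists (fun y => proj1_sig (f y)) => y z /fm.
Qed.

Lemma ole_or_gt (a b : Ord) : ole a b \/ olt b a.
Proof.
elim/(well_founded_ind olt_wf): a => a IH.
have [le_b|/existsNP[x nlt]] := pselect (forall x : a, olt (oseg x) b).
  by left; exact: segs_ole.
right; case: (IH _ (olt_oseg x)) => [[//|xb]|bx].
  by exists x; exact: oeq_sym.
exact: olt_trans bx (olt_oseg x).
Qed.

Lemma ole_oseg (a : Ord) (x y : a) :
  ole (oseg x) (oseg y) <-> orel x y \/ x = y.
Proof.
split=> [[/oseg_lt_rel|/oseg_inj]|[/oseg_lt|->]];
by [left|right|exact: ole_refl].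
Qed.

Lemma ole_total_rel (a : Ord) (x y : a) : ~ orel x y -> orel y x \/ y = x.
Proof. by case: (orel_total x y) => [//|[->|]]; [right|left]. Qed.

Lemma omin_least (P : Ord -> Prop) : (exists a, P a) -> oleast P (omin P).
Proof.
move=> exP; rewrite /omin; case: pselect => [h|[]]; first by case: cid.
case: exP => a; elim/(well_founded_ind olt_wf): a => a IH Pa.
have [[b ba Pb]|nb] := pselect (exists2 b, olt b a & P b); first exact: IH Pb.
exists a; split=> // b Pb; case: (ole_or_gt a b) => // ba.
by case: nb; exists b.
Qed.

(** * Comparing cardinalities *)

Definition embeds (S T : Type) : Prop := exists f : S -> T, injective f.

Lemma embeds_refl (T : Type) : embeds T T.
Proof. by exists id. Qed.

Lemma embeds_trans (S T U : Type) : embeds S T -> embeds T U -> embeds S U.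
Proof. by move=> [f fi] [g gi]; exists (g \o f); exact: inj_comp. Qed.

Lemma card_le_embeds (S T : Type) :
  card_le [set: S] [set: T] <-> embeds S T.
Proof.
split=> [/card_leP[f]|[f fi]].
  have St (x : S) : x \in [set: S] by rewrite in_setT.
  exists (fun x => val (f (SigSub (St x)))) => x y /val_inj.
  by move=> /(@inj _ _ _ f); rewrite !in_setT => /(_ isT isT)[].
elim/Ppointed: T f fi => T f fi; last first.
  by apply/pcard_injP; exists f => x y _ _; exact: fi.
have -> : [set: S] = set0 by rewrite -subset0 => x _; exact: (no (f x)).
exact: card_ge0.
Qed.

Lemma embeds_prod (S S' T T' : Type) :
  embeds S S' -> embeds T T' -> embeds (S * T) (S' * T').
Proof.
move=> [f fi] [g gi]; exists (fun p => (f p.1, g p.2)).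
by move=> [x y] [x' y'] [/fi/= -> /gi/= ->].
Qed.

Lemma embeds_set (S T : Type) : embeds S T -> embeds (set S) (set T).
Proof.
have sub (f : S -> T) (A B : set S) :
    injective f -> f @` A = f @` B -> A `<=` B.
  move=> fi AB x Ax; have : (f @` B) (f x) by rewrite -AB; exists x.
  by move=> [y By /fi <-].
move=> [f fi]; exists (fun A => f @` A) => A B AB.
by apply/seteqP; split; apply: (sub f).
Qed.

Lemma embeds_fun (S T : Type) : embeds (S -> T) (set (S * T)).
Proof.
exists (fun f => [set p | f p.1 = p.2]) => f g fg; apply: funext => x.
by have : [set p | f p.1 = p.2] (x, f x) by []; rewrite fg => /= ->.
Qed.

Lemma dep_choice (I : Type) (T : I -> Type) (P : forall i, T i -> Prop) :
  (forall i, exists t, P i t) ->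
  exists h : forall i, T i, forall i, P i (h i).
Proof.
move=> PT; exists (fun i => proj1_sig (cid (PT i))) => i.
exact: (proj2_sig (cid (PT i))).
Qed.

Lemma embeds_sigT (I U V : Type) (T : I -> Type) :
  embeds I U -> (forall i, embeds (T i) V) -> embeds {i & T i} (U * V).
Proof.
move=> [f fi] /dep_choice[h hi].
exists (fun p => (f (tag p), h (tag p) (tagged p))).
by move=> [i t] [j u] /= [/fi ij]; subst j => /hi->.
Qed.

Lemma ole_embeds (a b : Ord) : ole a b -> embeds a b.
Proof. by move=> /ole_smono[f /smono_inj]; exists f. Qed.

Lemma oeq_embeds (a b : Ord) : oeq a b -> embeds a b.
Proof. by move=> ab; apply: ole_embeds; right. Qed.

Lemma oseg_embeds (a : Ord) (x : a) : embeds (oseg x) a.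
Proof. by apply: ole_embeds; left; exact: olt_oseg. Qed.

Lemma oseg_embeds_oseg (a : Ord) (x y : a) : ~ orel y x ->
  embeds (oseg x) (oseg y).
Proof.
by move=> /ole_total_rel xy; apply/ole_embeds/ole_oseg.
Qed.

Section Pullback.
Variables (T : Type) (a : Ord) (f : T -> a).
Hypothesis fi : injective f.

Lemma opull_trans x y z :
  orel (f x) (f y) -> orel (f y) (f z) -> orel (f x) (f z).
Proof. exact: orel_trans. Qed.

Lemma opull_total x y : orel (f x) (f y) \/ x = y \/ orel (f y) (f x).
Proof.
by case: (orel_total (f x) (f y)) => [|[/fi|]]; [left|right; left|right; right].
Qed.

Lemma opull_wf : well_founded (fun x y => orel (f x) (f y)).
Proof.
move=> x; move: {2}(f x) (erefl (f x)) => y.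
elim/(well_founded_ind (@orel_wf a)): y x => y IH x fx.
by constructor=> z zx; apply: (IH (f z)) => //; rewrite -fx.
Qed.

Definition opull : Ord := MkOrd opull_trans opull_total opull_wf.
End Pullback.

Section NatOrd.
Lemma onat_total (m n : nat) : (m < n)%N \/ m = n \/ (n < m)%N.
Proof. by case: (ltngtP m n) => [|?|]; [left|right; right|right; left]. Qed.

Lemma onat_wf : well_founded (fun m n : nat => (m < n)%N).
Proof. by elim/ltn_ind => n IH; constructor. Qed.

Definition onat : Ord :=
  MkOrd (fun m n p => @ltn_trans n m p) onat_total onat_wf.
End NatOrd.

Lemma well_orderable (T : Type) :
  exists a : Ord, exists f : T -> a, bijective f.
Proof.
have [R Rwo] := well_ordering_principle {classic T}.
pose r (x y : T) := (R x y : Prop) /\ x <> y.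
have Rmin (P : T -> Prop) : (exists x, P x) ->
    exists2 x, P x & forall y, P y -> R x y.
  move=> [x Px]; have [|z [[zP zmin] _]] := Rwo [pred x : T | `[<P x>]].
    by exists x; exact/asboolP.
  by exists z => [|y Py]; [exact/asboolP|apply: zmin; exact/asboolP].
have anti (x y : T) : R x y -> R y x -> x = y.
  move=> xy yx; have [|z [_ zu]] := Rwo [pred z : T | `[<z = x \/ z = y>]].
    by exists x; apply/asboolP; left.
  have xx t : R t t.
    by have [|u -> ] := Rmin (eq^~ t); [exists t|apply].
  have mx : minimum_of R [pred z : T | `[<z = x \/ z = y>]] x.
    by split=> [|t /asboolP[->|->] //]; apply/asboolP; left.
  have my : minimum_of R [pred z : T | `[<z = x \/ z = y>]] y.
    by split=> [|t /asboolP[->|->] //]; apply/asboolP; right.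
  by rewrite -(zu _ mx) -(zu _ my).
have tot (x y : T) : R x y \/ R y x.
  have [|z zP zm] := Rmin (fun z => z = x \/ z = y); first by exists x; left.
  by case: zP zm => -> zm; [left|right]; apply: zm; [right|left].
have r_wf : well_founded r.
  move=> x; apply: contrapT => nAx.
  have [|z nAz zm] := Rmin (fun z => ~ Acc r z); first by exists x.
  apply: nAz; constructor=> y [yz ynz]; apply: contrapT => /zm zy.
  by apply: ynz; exact: anti.
have r_total x y : r x y \/ x = y \/ r y x.
  have [->|xy] := pselect (x = y); first by right; left.
  by case: (tot x y) => ?; [left|right; right]; split=> // /esym.
have r_trans x y z : r x y -> r y z -> r x z.
  move=> xy yz; case: (r_total x z) => [//|[xz|zx]].
    case: yz xy => yz ynz [xy xny]; subst z.
    by case: xny; exact: anti.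
  exfalso; elim/(well_founded_ind r_wf): x y z xy yz zx => x IH y z xy yz zx.
  exact: (IH z zx x y zx xy yz).
by exists (MkOrd r_trans r_total r_wf), id; exists id.
Qed.

Lemma cantor (T : Type) : ~ embeds (set T) T.
Proof.
move=> [f fi]; pose D : set T := [set x | exists2 A, f A = x & ~ A x].
have [DfD|nDfD] := pselect (D (f D)).
  by have [A /fi-> ] := DfD; apply.
by apply: (nDfD); exists D.
Qed.

(** Making room for one more element along a copy of [nat]. *)
Lemma closed_seg_embeds (a : Ord) (x : a) : embeds nat (oseg x) ->
  embeds {y : a | ~ orel x y} (oseg x).
Proof.
move=> [e ei].
pose shift (s : oseg x) : oseg x :=
  match pselect (exists n, e n = s) with
  | left h => e (proj1_sig (cid h)).+1
  | right _ => s
  end.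
have shiftE n : shift (e n) = e n.+1.
  rewrite /shift; case: pselect => [h|[]]; last by exists n.
  by case: cid => m /= /ei->.
have shiftN s : ~ (exists n, e n = s) -> shift s = s.
  by rewrite /shift; case: pselect.
have shift_inj : injective shift.
  move=> s t; have [[m <-]|sN] := pselect (exists n, e n = s);
    have [[n <-]|tN] := pselect (exists n, e n = t).
  - by rewrite !shiftE => /ei[->].
  - by rewrite shiftE shiftN // => mt; case: tN; exists m.+1.
  - by rewrite shiftE shiftN // => sn; case: sN; exists n.+1.
  - by rewrite !shiftN.
have shift0 s : shift s <> e 0%N.
  have [[m <-]|sN] := pselect (exists n, e n = s).
    by rewrite shiftE => /ei.
  by rewrite shiftN // => s0; apply: sN; exists 0%N.
exists (fun y => match pselect (orel (proj1_sig y) x) with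
  | left h => shift (exist _ (proj1_sig y) h)
  | right _ => e 0%N
  end).
move=> [y xy] [z xz] /=; case: pselect => yx; case: pselect => zx.
- by move=> /shift_inj[yz]; exact: eq_exist.
- by move=> /shift0.
- by move=> /esym/shift0.
- move=> _; apply: eq_exist; case: (ole_total_rel xy) => [//|->].
  by case: (ole_total_rel xz).
Qed.

(** Order the pairs by their maximum first. A pair with maximum [m] then has at
    most |m + 1|^2 predecessors; if [a] were shorter than this well-order of
    [a * a], it would be no larger than the square of one of its proper
    segments, hence, by induction, than that segment. *)
Lemma square_embeds (a : Ord) : embeds nat a -> embeds (a * a) a.
Proof.
elim/(well_founded_ind olt_wf): a => a IH nat_a.
have [[x ax]|a_card] := pselect (exists x : a, embeds a (oseg x)).
  have := embeds_prod ax ax; move=> /embeds_trans; apply.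
  apply: embeds_trans (oseg_embeds x).
  by apply: IH; [exact: olt_oseg|exact: embeds_trans ax].
case: (ole_or_gt a onat) => [/ole_embeds a_nat|[w /oeq_embeds nat_w]].
  apply: embeds_trans (embeds_prod a_nat a_nat) _; apply: embeds_trans nat_a.
  by exists (@pickle (nat * nat)%type); exact: pcan_inj pickleK.
pose mx (u : a * a) : a := if pselect (orel u.1 u.2) then u.2 else u.1.
have mx_ge u : ~ orel (mx u) u.1 /\ ~ orel (mx u) u.2.
  rewrite /mx; case: pselect => h; last by split=> //; exact: orel_irr.
  by split; [exact: orel_asym|exact: orel_irr].
pose g (u : a * a) : omul (omul a a) a := (u, mx u).
have gi : injective g by move=> u v [].
case: (ole_or_gt (opull gi) a) => [/ole_embeds//|[u0 /oeq_embeds au0]].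
have [m [mu0 mw]] : exists m, ~ orel m (mx u0) /\ ~ orel m w.
  have [mw|wm] := pselect (orel (mx u0) w).
    by exists w; split; [exact: orel_asym|exact: orel_irr].
  by exists (mx u0); split=> //; exact: orel_irr.
have nat_m : embeds nat (oseg m).
  by apply: embeds_trans nat_w _; exact: oseg_embeds_oseg.
have lem (v : oseg u0) :
    ~ orel m (proj1_sig v).1 /\ ~ orel m (proj1_sig v).2.
  case: v => v vu0 /=; have [v1 v2] := mx_ge v.
  have vm : ~ orel m (mx v).
    case: vu0 => [/= vu0 mv|[/= -> _]] //.
    by apply: mu0; exact: orel_trans vu0.
  split=> mvi; [apply: v1|apply: v2]; case: (ole_total_rel vm) => [|->] //;
    by move=> /orel_trans; apply.
have u0m : embeds (oseg u0) ({y | ~ orel m y} * {y | ~ orel m y}).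
  exists (fun v => (exist (fun y => ~ orel m y) _ (lem v).1,
                    exist (fun y => ~ orel m y) _ (lem v).2)).
  move=> [[x y] xy] [[x' y'] xy'] [/= xx' yy'].
  by apply: eq_exist; congr pair.
case: a_card; exists m; apply: embeds_trans au0 (embeds_trans u0m _).
have mm := closed_seg_embeds nat_m.
apply: embeds_trans (embeds_prod mm mm) _.
by apply: IH => //; exact: olt_oseg.
Qed.

(** * Sizes below a singular strong limit cardinal *)

Definition small (k : Ord) (T : Type) : Prop :=
  exists x : k, embeds T (oseg x).

Lemma small_embeds (k : Ord) (S T : Type) :
  embeds S T -> small k T -> small k S.
Proof. by move=> ST [x Tx]; exists x; exact: embeds_trans Tx. Qed.

Lemma small_le (k : Ord) (T : Type) : small k T -> embeds T k.
Proof. by move=> [x Tx]; exact: embeds_trans (oseg_embeds x). Qed.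

Lemma small_oseg (k : Ord) (x : k) : small k (oseg x).
Proof. by exists x; exact: embeds_refl. Qed.

Lemma olt_small (k d : Ord) : olt d k -> small k d.
Proof. by move=> [x /oeq_embeds]; exists x. Qed.

Lemma nsmall_embeds (k : Ord) (T : Type) : ~ small k T -> embeds k T.
Proof.
move=> nT; have [t [f [f' fK f'K]]] := well_orderable T.
have tT : embeds t T by exists f'; exact: can_inj f'K.
case: (ole_or_gt k t) => [/ole_embeds/embeds_trans|/olt_small]; first exact.
case=> x tx; case: nT; exists x; apply: embeds_trans tx.
by exists f; exact: can_inj fK.
Qed.

Lemma csucc_least (k : Ord) : oleast (fun a : Ord => ~ embeds a k) (csucc k).
Proof.
have : oleast (fun a : Ord => ~ card_le [set: a] [set: k]) (csucc k).
  apply: omin_least; have [a [f [f' fK f'K]]] := well_orderable (set k).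
  exists a => /card_le_embeds ak; apply: (@cantor k); apply: embeds_trans ak.
  by exists f; exact: can_inj fK.
case=> kk kmin; split=> [/card_le_embeds//|b bk].
by apply: kmin => /card_le_embeds.
Qed.

Lemma olt_csucc (k d : Ord) : olt d (csucc k) <-> embeds d k.
Proof.
have [kk kmin] := csucc_least k; split=> [dk|dk].
  by apply: contrapT => /kmin /(olt_nge dk).
case: (ole_or_gt (csucc k) d) => [/ole_embeds kd|//].
by case: kk; exact: embeds_trans kd dk.
Qed.

(** The union of [k] many sets of size at most [k] cannot exhaust [k]^+. *)
Lemma csucc_bounded (k : Ord) (T : Type) (f : T -> csucc k) :
  embeds nat k -> embeds T k -> exists y, forall i, orel (f i) y.
Proof.
move=> nat_k Tk; apply: contrapT => nb.
have [kk _] := csucc_least k; apply: kk.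
have cofin y : exists i, ~ orel (f i) y.
  by apply/existsNP => fy; apply: nb; exists y.
have seg_k (x : csucc k) : embeds (oseg x) k.
  by apply/olt_csucc; exact: olt_oseg.
have cl x : exists h : csucc k -> option k,
    forall y z, ~ orel x y -> ~ orel x z -> h y = h z -> y = z.
  have [e ei] := seg_k x.
  exists (fun y => match pselect (orel y x) with
    | left h => Some (e (exist _ y h)) | right _ => None end) => y z xy xz.
  case: pselect => // yx; case: pselect => // zx; first by case=> /ei[].
  by move=> _; case: (ole_total_rel xy) => // ->; case: (ole_total_rel xz).
have /choice[i iP] := cofin; have /choice[h hP] := cl.
have opt_k : embeds (option k) k.
  have [n ni] := nat_k; have [p pi] := square_embeds nat_k.
  exists (fun s => if s is Some x then p (n 1%N, x) else p (n 0%N, n 0%N)).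
  by move=> [x|] [y|] // /pi[] => [->|/ni|/ni].
apply: embeds_trans (square_embeds nat_k).
apply: embeds_trans (embeds_prod Tk opt_k).
exists (fun y => (i y, h (f (i y)) y)) => y z [iyz hyz].
by apply: (hP (f (i y))); [exact: iP|rewrite iyz; exact: iP|rewrite hyz iyz].
Qed.

Lemma csucc_succ (k : Ord) (x : csucc k) :
  embeds nat k -> exists y, orel x y.
Proof.
move=> nat_k; have [|y xy] := @csucc_bounded k unit (fun=> x) nat_k.
  by have [n ni] := nat_k; exists (fun=> n 0%N) => -[] [].
by exists y; exact: (xy tt).
Qed.

Section SingularStrongLimit.
Variable k : Ord.
Hypotheses (k_sing : singular k) (k_pow : oeq (pow2_lt k) k).

Lemma cardinal_nsmall : ~ small k k.
Proof. by case: k_sing => kc _ _ [x /card_le_embeds /kc]. Qed.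

Lemma small_nat : small k nat.
Proof.
case: k_sing => _ k_unc _; apply: contrapT => /nsmall_embeds.
by move=> /card_le_embeds.
Qed.

Lemma nat_le : embeds nat k.
Proof. exact: small_le small_nat. Qed.

Lemma small_bound (S T : Type) : small k S -> small k T ->
  exists x : k, [/\ embeds S (oseg x), embeds T (oseg x) & embeds nat (oseg x)].
Proof.
have bound S' T' : small k S' -> small k T' ->
    exists x : k, embeds S' (oseg x) /\ embeds T' (oseg x).
  move=> [x Sx] [y Ty]; have [xy|nxy] := pselect (orel x y).
    exists y; split=> //; apply: embeds_trans Sx _.
    by apply: oseg_embeds_oseg; exact: orel_asym.
  by exists x; split=> //; apply: embeds_trans Ty _; exact: oseg_embeds_oseg.
move=> /bound/[apply] -[x [Sx Tx]].
have [y [xy ny]] := bound _ _ (small_oseg x) small_nat.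
by exists y; split=> //; [exact: embeds_trans Sx xy|exact: embeds_trans Tx xy].
Qed.

Lemma small_prod (S T : Type) : small k S -> small k T -> small k (S * T).
Proof.
move=> /small_bound/[apply] -[x [Sx Tx nx]]; exists x.
exact: embeds_trans (embeds_prod Sx Tx) (square_embeds nx).
Qed.

Lemma cardinal_no_max (x : k) : exists y, orel x y.
Proof.
apply: contrapT => xmax.
have xge z : ~ orel x z by move=> xz; apply: xmax; exists z.
have [w [_ _ nw]] := small_bound small_nat small_nat.
have nx : embeds nat (oseg x) by apply: embeds_trans nw (oseg_embeds_oseg _).
apply: cardinal_nsmall; exists x; apply: embeds_trans (closed_seg_embeds nx).
by exists (fun z => exist _ z (xge z)) => y z [].
Qed.

Lemma cof_cofinal :
  exists f : cof k -> k, forall x, exists i, orel x (f i).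
Proof.
have : oleast (fun l : Ord => exists f : l -> k,
    forall x : k, exists i, orel x (f i) \/ x = f i) (cof k).
  by apply: omin_least; exists k, id => x; exists x; right.
case=> -[f fP] _; exists f => x; have [y xy] := cardinal_no_max x.
have [i [yf|yf]] := fP y; exists i; last by rewrite -yf.
exact: orel_trans yf.
Qed.

Lemma small_cof : small k (cof k).
Proof. by case: k_sing => _ _; exact: olt_small. Qed.

Lemma pow_le (x : k) : embeds (set (oseg x)) k.
Proof.
have : oleast (fun c : Ord => forall x : k,
    card_le [set: set (oseg x)] [set: c]) (pow2_lt k).
  apply: omin_least; have [a [f [f' fK f'K]]] := well_orderable (set k).
  exists a => y; apply/card_le_embeds.
  apply: embeds_trans (embeds_set (oseg_embeds y)) _.
  by exists f; exact: can_inj fK.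
case=> /(_ x)/card_le_embeds xk _; apply: embeds_trans xk _.
exact: oeq_embeds.
Qed.

(** If 2^T were at least [k] for some [T] of size less than [k], then enlarging
    [T] so that |T| >= cof k would embed all functions from [cof k] to [k] in
    2^T, hence in [k] as 2^{<k} = k. Koenig's diagonal argument excludes
    this. *)
Lemma small_set (T : Type) : small k T -> small k (set T).
Proof.
move=> Tk; have [x [Tx cx nx]] := small_bound Tk small_cof.
apply: contrapT => nT.
have kx : embeds k (set (oseg x)).
  exact: embeds_trans (nsmall_embeds nT) (embeds_set Tx).
have fun_k : embeds (cof k -> k) k.
  apply: embeds_trans (pow_le x).
  apply: embeds_trans (embeds_set (square_embeds nx)).
  apply: embeds_trans (embeds_set (embeds_prod cx (embeds_refl _))).
  have [e ei] := kx.
  exists (fun h => [set p | e (h p.1) p.2]) => g h gh; apply: funext => i.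
  apply: ei; apply: funext => s.
  by have := congr1 (fun A : set (cof k * oseg x) => A (i, s)) gh.
have [Phi Phi_inj] := fun_k; have [f f_cof] := cof_cofinal.
have diag i : exists y, forall g, orel (Phi g) (f i) -> g i <> y.
  apply: contrapT => /forallNP nd; apply: cardinal_nsmall; exists (f i).
  have /choice[G GP] : forall y, exists g : cof k -> k,
      orel (Phi g) (f i) /\ g i = y.
    move=> y; have /existsNP[g /not_implyP[gf /contrapT giy]] := nd y.
    by exists g.
  exists (fun y => exist _ (Phi (G y)) (GP y).1 : oseg (f i)).
  by move=> y z [/Phi_inj yz]; rewrite -(GP y).2 yz (GP z).2.
have /choice[h hP] := diag; have [i hi] := f_cof (Phi h).
exact: (hP i h hi).
Qed.

Lemma small_fun (S T : Type) : small k S -> small k T -> small k (S -> T).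
Proof.
move=> Sk Tk; apply: small_embeds (embeds_fun S T) _.
exact: small_set (small_prod Sk Tk).
Qed.

(** An ordinal of size at most [k] is a union of [cof k] many sets of size less
    than [k]; either one of them is cofinal, or their bounds are. *)
Lemma small_cofinal (a : Ord) : embeds a k -> exists M : Type,
  small k M /\ exists c : M -> a, forall x, exists m, ~ orel (c m) x.
Proof.
move=> [e ei]; have [f f_cof] := cof_cofinal.
have [[i ci]|nc] := pselect (exists i : cof k, forall x, exists y,
    orel (e y) (f i) /\ ~ orel y x).
  exists {y | orel (e y) (f i)}; split.
    exists (f i); exists (fun y : {y | orel (e y) (f i)} =>
      exist _ (e (proj1_sig y)) (proj2_sig y) : oseg (f i)).
    by move=> [y yf] [z zf] [/ei yz]; exact: eq_exist.
  exists (@proj1_sig _ _) => x; have [y [yf yx]] := ci x.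
  by exists (exist _ y yf).
have /choice[c cP] : forall i : cof k, exists x,
    forall y, orel (e y) (f i) -> orel y x.
  move=> i; apply: contrapT => /forallNP ni; apply: nc; exists i => x.
  by have /existsNP[y /not_implyP[yf yx]] := ni x; exists y.
exists (cof k); split; first exact: small_cof.
exists c => x; have [i xi] := f_cof (e x); exists i.
exact: orel_asym (cP _ _ xi).
Qed.

End SingularStrongLimit.

(** * Ordinal arithmetic *)

Lemma ole_addl (c a : Ord) : ole a (oadd c a).
Proof. exact: (@smono_ole _ (oadd c a) inr). Qed.

Lemma ole_addr (c a : Ord) : ole c (oadd c a).
Proof. exact: (@smono_ole _ (oadd c a) inl). Qed.

Lemma ole_add2l (c a b : Ord) : ole a b -> ole (oadd c a) (oadd c b).
Proof.
move=> /ole_smono[f fm]; apply: (@smono_ole (oadd c a) (oadd c b)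
  (fun u => match u with inl x => inl x | inr x => inr (f x) end)).
by move=> [x|x] [y|y] //; exact: fm.
Qed.

Lemma oeq_add2l (c a b : Ord) : oeq a b -> oeq (oadd c a) (oadd c b).
Proof.
move=> ab; apply: ole_antisym; apply: ole_add2l; right=> //; exact: oeq_sym.
Qed.

Lemma ole_double (a : Ord) : ole a (omul otwo a).
Proof.
apply: (@smono_ole a (omul otwo a) (fun x => (inl tt, x))).
by move=> x y; left.
Qed.

Lemma oseg_add (c a : Ord) (x : a) :
  oeq (oseg (inr x : oadd c a)) (oadd c (oseg x)).
Proof.
apply: oeq_sym; pose f (u : oadd c (oseg x)) : oseg (inr x : oadd c a) :=
  match u with
  | inl y => exist (fun v : oadd c a => orel v (inr x)) (inl y) I
  | inr (exist y yx) => exist (fun v : oadd c a => orel v (inr x)) (inr y) yx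
  end.
apply: (@smono_surj_oeq _ _ f); first by move=> [y|[y yx]] [z|[z zx]].
move=> [[y|y] yx]; last by exists (inr (exist _ y yx)).
by exists (inl y); exact: eq_exist.
Qed.

Lemma oseg_double (a : Ord) (x : a) :
  oeq (oseg ((inl tt, x) : omul otwo a)) (omul otwo (oseg x)).
Proof.
apply: oeq_sym.
have lt_x (u : omul otwo (oseg x)) :
    @orel (omul otwo a) (u.1, proj1_sig u.2) (inl tt, x).
  by left; exact: (proj2_sig u.2).
apply: (@smono_surj_oeq _ _ (fun u =>
    exist (fun v : omul otwo a => orel v (inl tt, x)) _ (lt_x u)
      : oseg ((inl tt, x) : omul otwo a))).
  move=> [i [y yx]] [j [z zx]] [/= yz|[[/= yz] ij]]; first by left.
  by right; split=> //=.
move=> [[i y] yx]; have yx' : orel y x by case: yx => [//|[_]]; case: i.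
by exists (i, exist _ y yx'); exact: eq_exist.
Qed.

Lemma oseg_1double (a : Ord) (x : a) :
  oeq (oseg (inr (inl tt, x) : oadd oone (omul otwo a)))
      (oadd oone (omul otwo (oseg x))).
Proof.
by apply: oeq_trans (oseg_add _ _) _; apply: oeq_add2l; exact: oseg_double.
Qed.

Lemma olt_1add (a c : Ord) : olt c (oadd oone a) -> ole oone c ->
  exists x : a, oeq c (oadd oone (oseg x)).
Proof.
move=> [[x|x] cx] c1; last by exists x; exact: oeq_trans cx (oseg_add _ _).
have /ole_smono[f _] : ole oone (oseg (inl x : oadd oone a)).
  by apply: ole_trans c1 _; right.
by case: (f tt) => -[].
Qed.

Lemma oadd_empty (c a : Ord) : (a -> False) -> oeq (oadd c a) c.
Proof.
move=> a0; apply: ole_antisym (ole_addr _ _).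
apply: (@smono_ole _ _ (fun u : oadd c a =>
  match u with inl x => x | inr y => match a0 y with end end)).
by move=> [y|y] [z|z].
Qed.

Lemma olt_two (c : Ord) : olt c otwo -> ole oone c -> oeq c oone.
Proof.
move=> c2 c1; have [x cx] := olt_1add c2 c1; apply: oeq_trans cx _.
by apply: oadd_empty => -[[]].
Qed.

Lemma two_le (a : Ord) : olt oone a -> ole otwo a.
Proof.
move=> a1; case: (ole_or_gt otwo a) => // a2.
have a1' : oeq a oone by apply: olt_two a2 _; left.
by case: (olt_irr (olt_eqr a1 a1')).
Qed.

(** The ordinal 1 + 2.x + 1, where [x] stands for an ordinal below [a]; it is
    the second of the two levels which the copy number [x] of 2 contributes to
    1 + 2.a. *)
Definition odd_level (a : Ord) (x : a) : Ord :=
  oseg (inr (inr tt, x) : oadd oone (omul otwo a)).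

Lemma odd_level_lt (a : Ord) (x : a) :
  olt (odd_level x) (oadd oone (omul otwo a)).
Proof. exact: olt_oseg. Qed.

Lemma odd_level_gt (a : Ord) (x : a) :
  olt (oadd oone (omul otwo (oseg x))) (odd_level x).
Proof.
apply: oeq_ltl (oeq_sym (oseg_1double x)) _; apply: oseg_lt.
by right.
Qed.

Lemma odd_level_succ (a : Ord) (x : a) (c : Ord) :
  olt c (odd_level x) -> ole c (oadd oone (omul otwo (oseg x))).
Proof.
move=> /olt_osegP[u ux cu]; apply: ole_trans (or_intror cu) _.
apply: ole_trans (or_intror (oseg_1double x)); apply/ole_oseg.
case: u ux {cu} => [[] _|[i y] ux]; first by left.
case: ux => [/= yx|[/= -> iy]]; first by left; left.
by case: i iy => [[] _|//]; right.
Qed.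

Lemma olt_1double (a c : Ord) :
  olt c (oadd oone (omul otwo a)) -> ole oone c ->
  exists x : a, ole c (odd_level x).
Proof.
move=> [[x|[i x]] cx] c1.
  have /ole_smono[f _] := ole_trans c1 (or_intror cx).
  by case: (f tt) => -[].
exists x; apply: ole_trans (or_intror cx) _; apply/ole_oseg.
by case: i {cx} => -[]; [left; right|right].
Qed.

Lemma olt_add_oseg (a : Ord) (x : a) : olt (oadd oone (oseg x)) (oadd oone a).
Proof. by exists (inr x); exact: oeq_sym (oseg_add _ _). Qed.

Lemma olt_1add_pos (a : Ord) : a -> olt oone (oadd oone a).
Proof. by move=> x; exact: ole_lt_trans (ole_addr _ _) (olt_add_oseg x). Qed.

Lemma olt_1double_pos (a : Ord) : a -> olt oone (oadd oone (omul otwo a)).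
Proof. by move=> x; apply: olt_1add_pos; exact: (inl tt, x). Qed.

Lemma olimit_oeq (a b : Ord) : oeq a b -> olimit a -> olimit b.
Proof.
move=> /oeq_smono[f [fm fs]] [[x] amax]; split; first by split; exact: f x.
move=> y; have [z <-] := fs y; have [z' zz'] := amax z.
by exists (f z'); exact: fm.
Qed.

(** The successor map of [a] shifts 1 + [a] into [a]. *)
Lemma limit_1add (a : Ord) : olimit a -> ole (oadd oone a) a.
Proof.
move=> [[x0] amax].
have [z0 _ z0min] : exists2 z : a, True & forall y, orel y z -> ~ True.
  by apply: orel_least; exists x0.
have /choice[s sP] : forall x : a, exists s,
    orel x s /\ forall y, orel x y -> ~ orel y s.
  move=> x; have [s xs smin] := orel_least (amax x).
  by exists s; split=> // y xy /smin.
apply: (@smono_ole _ _ (fun u : oadd oone a =>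
  match u with inl _ => z0 | inr x => s x end)).
move=> [x|x] [y|y] //= xy.
  have [ys _] := sP y; case: (orel_total z0 (s y)) => [//|[z0s|/z0min[]//]].
  by rewrite -z0s in ys; case: (z0min _ ys).
have [_ smin] := sP x; have := smin _ xy; move/ole_total_rel => sy.
by case: (sP y) => ys _; case: sy => [/orel_trans|->]; [apply|].
Qed.

(** If 2.a were longer than a limit [a], then [a] would be a segment of 2.a
    without last element, hence of the form 2.x for a limit x < [a], and
    already 2.x would be longer than x. *)
Lemma limit_double (a : Ord) : olimit a -> ole (omul otwo a) a.
Proof.
elim/(well_founded_ind olt_wf): a => a IH alim.
case: (ole_or_gt (omul otwo a) a) => // -[[[[]|[]] x] ax]; last first.
  have [_ /(_ (exist _ (inl tt, x) (or_intror (conj erefl I))))] :=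
    olimit_oeq ax alim.
  move=> [[[i y] yx] /= xy]; case: yx xy => [/= yx|[/= -> iy]].
    case=> [/= /(orel_asym yx)|[/= xy _]] //.
    by rewrite xy in yx; case: (orel_irr yx).
  by case: i iy => // -[] _ [/= /orel_irr|[]].
have [[[[i y] yx]] umax] := olimit_oeq ax alim.
have yx' : orel y x by case: yx => [//|[_]]; case: i.
have xlim : olimit (oseg x).
  split; first by split; exists y.
  move=> [z zx]; have zx1 : @orel (omul otwo a) (inr tt, z) (inl tt, x) by left.
  have [[[j t] tx] zt] :=
    umax (exist (fun v : omul otwo a => orel v (inl tt, x)) _ zx1).
  have tx' : orel t x by case: tx {zt} => [//|[_]]; case: j.
  by exists (exist _ t tx'); case: zt => [//|[_]] /=; case: j {tx}.
have /ole_lt_trans := IH _ (olt_oseg x) xlim.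
move=> /(_ _ (olt_oseg x)) lt_a.
case: (olt_irr (a := a)); apply: oeq_ltl lt_a.
exact: oeq_trans ax (oseg_double x).
Qed.

Lemma limit_1double (a : Ord) : olimit a -> ole (oadd oone (omul otwo a)) a.
Proof.
move=> alim; apply: ole_trans (limit_1add alim).
by apply: ole_add2l; exact: limit_double.
Qed.

(** * The hierarchy for an arbitrary bound on the length of unions *)

(** Here [d] ranges over all well-orders of subsets of [T], so that families
    indexed by types without a given order, such as pairs or functions, can be
    used in unions. *)
Definition sized (g : Ord) (T : Type) : Prop :=
  forall d : Ord, embeds d T -> olt d g.

Lemma small_sized (k : Ord) (T : Type) :
  is_cardinal k -> small k T -> sized k T.
Proof.
move=> kc [x Tx] d dT; case: (ole_or_gt k d) => // /ole_embeds kd.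
case: (kc x); apply/card_le_embeds.
exact: embeds_trans kd (embeds_trans dT Tx).
Qed.

Lemma csucc_sized (k : Ord) (T : Type) : embeds T k -> sized (csucc k) T.
Proof. by move=> Tk d dT; apply/olt_csucc; exact: embeds_trans Tk. Qed.

Section Hierarchy.
Variables (g : Ord) (X : topologicalType).

Lemma Sigma_oeq (a b : Ord) (A : set X) :
  oeq a b -> Sigma g X a A -> Sigma g X b A.
Proof.
move=> ab SA; case: SA ab => [c U c1 oU|c d B l c1 dg l1 lc BS] cb.
  by apply: Sigma_open => //; exact: oeq_trans (oeq_sym cb) c1.
by apply: (Sigma_bigcup (b := l)) => // [|i]; exact: olt_eqr cb.
Qed.

Lemma Sigma_ounion (a d : Ord) (A : d -> set X) : olt oone a -> olt d g ->
  (forall i, exists b, [/\ ole oone b, olt b a & Sigma g X b (~` A i)]) ->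
  Sigma g X a (\bigcup_i A i).
Proof.
move=> a1 dg /choice[l lP].
by apply: (Sigma_bigcup (b := l)) => // i; have [] := lP i.
Qed.

Lemma Sigma_union (a : Ord) (T : Type) (A : T -> set X) :
  olt oone a -> sized g T ->
  (forall i, exists b, [/\ ole oone b, olt b a & Sigma g X b (~` A i)]) ->
  Sigma g X a (\bigcup_i A i).
Proof.
move=> a1 Tg AP; have [d [f [f' fK f'K]]] := well_orderable T.
have -> : \bigcup_i A i = \bigcup_(j : d) A (f' j).
  apply/seteqP; split=> x [i _ Ax]; last by exists (f' i).
  by exists (f i); rewrite // fK.
apply: Sigma_ounion => //.
by apply: Tg; exists f'; exact: can_inj f'K.
Qed.

Lemma SigmaP (a : Ord) (B : set X) : Sigma g X a B -> olt oone a ->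
  exists (d : Ord) (A : d -> set X), [/\ olt d g, B = \bigcup_i A i &
    forall i, exists b, [/\ ole oone b, olt b a & Sigma g X b (~` A i)]].
Proof.
case=> [c U c1 oU a1|c d A l c1 dg l1 lc BS _].
  by case: (olt_irr (olt_eqr a1 c1)).
by exists d, A; split=> // i; exists (l i).
Qed.

Lemma Sigma_oneP (a : Ord) (U : set X) : oeq a oone -> Sigma g X a U <-> open U.
Proof.
move=> a1; split=> [SU|oU]; last exact: Sigma_open.
case: SU a1 => [b V _ oV _ //|c d A l c1 _ _ _ _ a1].
by case: (olt_irr (olt_eqr c1 a1)).
Qed.

Lemma Sigma_pos (a : Ord) (A : set X) : Sigma g X a A -> ole oone a.
Proof. by case=> [b U /oeq_sym|]; [right|left]. Qed.

Lemma Sigma_mono_gt1 (a b : Ord) : olt oone a -> ole a b ->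
  Sigma g X a `<=` Sigma g X b.
Proof.
move=> a1 ab A; case: (ab) => [_|/Sigma_oeq]; last exact.
move=> /SigmaP/(_ a1)[d [B [dg -> BP]]].
apply: Sigma_ounion => // [|i]; first exact: olt_le_trans ab.
by have [c [c1 ca Bc]] := BP i; exists c; split=> //; exact: olt_le_trans ab.
Qed.

Lemma olt_one_two : olt oone otwo.
Proof. by apply: olt_1add_pos; exact: tt. Qed.

Section OpenSigma2.
(** Only at the first level can the hierarchy fail to increase, as an open set
    need not be a union of few closed sets. *)
Hypothesis open2 : open `<=` Sigma g X otwo.

Lemma Sigma_mono (a b : Ord) : ole a b -> Sigma g X a `<=` Sigma g X b.
Proof.
move=> ab A SA; case: (Sigma_pos SA) => [a1|/oeq_sym a1].
  exact: Sigma_mono_gt1 ab _ SA.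
case: ab => [ab|]; last by move=> /Sigma_oeq; apply.
have b1 : olt oone b := oeq_ltl (oeq_sym a1) ab.
apply: Sigma_mono_gt1 olt_one_two (two_le b1) _ _; apply: open2.
exact/(Sigma_oneP _ a1).
Qed.

Lemma Bor_algebra : gamma_algebra g (Bor g X).
Proof.
split=> [A BA F [Fa Fo]|d A dg BA F [Fa Fo]]; first by apply: Fa.1; exact: BA.
by apply: Fa.2 => // i; exact: BA.
Qed.

Lemma Sigma_sub_Bor (a : Ord) : Sigma g X a `<=` Bor g X.
Proof.
move=> A; elim=> {a A} [a U _ oU|a d A b _ dg _ _ _ BA].
  exact: sub_gen_smallest.
have [BC BU] := Bor_algebra; apply: BU => // i.
by rewrite -[A i]setCK; apply: BC.
Qed.

Section Bounded.
Variable k : Ord.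
Hypotheses (nat_k : embeds nat k) (g_le : forall d, olt d g -> embeds d k).
Hypothesis unit_g : sized g unit.

Lemma one_csucc : olt oone (csucc k).
Proof.
by apply/olt_csucc; case: nat_k => n _; exists (fun=> n 0%N) => -[] [].
Qed.

(** Fewer than k^+ levels below k^+ have an upper bound below k^+, so the
    classes below k^+ form together a [g]-algebra. *)
Lemma Sigma_csucc : Sigma g X (csucc k) = Bor g X.
Proof.
apply/seteqP; split; first exact: Sigma_sub_Bor.
pose F (A : set X) := exists x : csucc k, Sigma g X (oseg x) A.
suff BF : Bor g X `<=` F.
  by move=> A /BF[x]; apply: Sigma_mono; left; exact: olt_oseg.
have FC A : F A -> F (~` A).
  move=> [x SA]; have [y xy] := csucc_succ x nat_k; exists y.
  have -> : ~` A = \bigcup_(i : unit) ~` A.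
    by apply/seteqP; split=> z; [exists tt|case].
  have x1 := Sigma_pos SA.
  apply: Sigma_union => // [|_]; first exact: ole_lt_trans (oseg_lt xy).
  by exists (oseg x); rewrite setCK; split=> //; exact: oseg_lt.
apply: smallest_sub; last first.
  move=> U oU; have [x /oeq_sym x1] := one_csucc.
  by exists x; apply/(Sigma_oneP _ x1).
split=> // d A dg AF.
have /choice[x xP] : forall i, exists x : csucc k, Sigma g X (oseg x) (~` A i).
  by move=> i; exact/FC.
have [y yP] := csucc_bounded x nat_k (g_le dg).
have [t /oeq_sym t1] := one_csucc.
have [v yv tv] : exists2 v, ~ orel v y & orel t v.
  have [ty|nty] := pselect (orel t y); first by exists y => //; exact: orel_irr.
  have [v tv] := csucc_succ t nat_k; exists v => // vy.
  by apply: nty; exact: orel_trans vy.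
exists v; apply: Sigma_ounion => // [|i].
  exact: oeq_ltl (oeq_sym t1) (oseg_lt tv).
exists (oseg (x i)); split=> //; first exact: Sigma_pos (xP i).
apply: oseg_lt; have := yP i; case: (ole_total_rel yv) => [yv'|->//].
by move=> /orel_trans; apply.
Qed.

Lemma borel_ord_least :
  oleast (fun a => ole oone a /\ Sigma g X a = Bor g X) (borel_ord g X).
Proof.
apply: omin_least; exists (csucc k); split; last exact: Sigma_csucc.
by left; exact: one_csucc.
Qed.

Lemma borel_ord_le_csucc : ole (borel_ord g X) (csucc k).
Proof.
have [_] := borel_ord_least; apply; split; last exact: Sigma_csucc.
by left; exact: one_csucc.
Qed.

Lemma borel_ord_leP (a : Ord) : ole oone a ->
  ole (borel_ord g X) a <-> Sigma g X a = Bor g X.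
Proof.
move=> a1; have [[_ SB] ord_min] := borel_ord_least.
split=> [ord_a|Sa]; last by apply: ord_min.
apply/seteqP; split; first exact: Sigma_sub_Bor.
by rewrite -SB; exact: Sigma_mono.
Qed.

End Bounded.
End OpenSigma2.
End Hierarchy.

(** * The two hierarchies at a singular strong limit cardinal *)

Section TwoHierarchies.
Variables (k : Ord) (X : topologicalType).
Hypotheses (k_sing : singular k) (k_pow : oeq (pow2_lt k) k).
Hypothesis X_open : Sigma k X oone `<=` Sigma (csucc (cof k)) X otwo.

Let k_card : is_cardinal k. Proof. by case: k_sing. Qed.
Let nat_k : embeds nat k. Proof. exact: nat_le. Qed.

Lemma open_cof_union (U : set X) : open U -> exists (T : Type) (C : T -> set X),
  [/\ embeds T (cof k), U = \bigcup_i C i & forall i, open (~` C i)].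
Proof.
move=> oU; have U1 : Sigma k X oone U by apply/(Sigma_oneP _ _ (oeq_refl _)).
have [d [C [dk -> CP]]] := SigmaP (X_open U1) olt_one_two.
exists d, C; split=> // [|i]; first exact/olt_csucc.
have [b [b1 b2 Cb]] := CP i.
by apply/(Sigma_oneP (csucc (cof k)) _ (olt_two b2 b1)).
Qed.

Lemma open_Sigma2 (g : Ord) : sized g (cof k) -> open `<=` Sigma g X otwo.
Proof.
move=> cof_g U /open_cof_union[T [C [Tc -> CP]]].
apply: Sigma_union olt_one_two _ _ => [d dT|i].
  by apply: cof_g; exact: embeds_trans Tc.
exists oone; split; [exact: ole_refl|exact: olt_one_two|].
exact/(Sigma_oneP _ _ (oeq_refl _)).
Qed.

Lemma cof_sized : sized k (cof k).
Proof. exact: small_sized k_card (small_cof k_sing). Qed.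

Lemma cof_csucc_sized : sized (csucc k) (cof k).
Proof. exact: csucc_sized (small_le (small_cof k_sing)). Qed.

Lemma Sigma_k_mono (a b : Ord) : ole a b -> Sigma k X a `<=` Sigma k X b.
Proof. exact: Sigma_mono (open_Sigma2 cof_sized) _ _. Qed.

(** As [k * k] embeds in [k], a [k]-union of [k]-unions is a [k]-union. *)
Lemma Sigma_csucc_union (a : Ord) (T : Type) (A : T -> set X) :
  ole oone a -> embeds T k -> (forall i, Sigma (csucc k) X a (A i)) ->
  Sigma (csucc k) X a (\bigcup_i A i).
Proof.
move=> [a1|/oeq_sym a1] Tk AP; last first.
  apply/(Sigma_oneP _ _ a1); apply: bigcup_open => i _.
  exact/(Sigma_oneP (csucc k) _ a1).
have /choice[D DP] : forall i, exists D : {d : Ord & d -> set X},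
    [/\ embeds (projT1 D) k, A i = \bigcup_j projT2 D j &
      forall j, exists b, [/\ ole oone b, olt b a &
        Sigma (csucc k) X b (~` projT2 D j)]].
  move=> i; have [d [B [dk AB BP]]] := SigmaP (AP i) a1.
  by exists (existT _ d B); split=> //; exact/olt_csucc.
have -> : \bigcup_i A i =
    \bigcup_(p : {i & projT1 (D i)}) projT2 (D (projT1 p)) (projT2 p).
  apply/seteqP; split=> x.
    move=> [i _]; have [_ -> _] := DP i => -[j _ Dx].
    by exists (existT _ i j).
  move=> [[i j] _ /= Dx]; exists i => //; have [_ -> _] := DP i.
  by exists j.
apply: Sigma_union => // [|[i j]]; last by have [_ _] := DP i; apply.
apply: csucc_sized; apply: embeds_trans (square_embeds nat_k).
by apply: embeds_sigT Tk _ => i; have [] := DP i.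
Qed.

(** An intersection of fewer than [k] unions, each of at most |N| < k sets, is
    by distributivity a union indexed by choice functions, and there are fewer
    than [k] of these as [k] is a strong limit. *)
Lemma Sigma_succ_compl (c c' : Ord) (N : Type) : small k N ->
  ole oone c -> olt c c' -> (forall b, olt b c' -> ole b c) ->
  (forall A, Sigma k X c A -> exists (T : Type) (B : T -> set X),
    [/\ embeds T N, A = \bigcup_t B t & forall t, Sigma k X c (~` B t)]) ->
  (forall (T : Type) (A : T -> set X), small k T ->
    (forall t, Sigma k X c (A t)) -> Sigma k X c (\bigcup_t A t)) ->
  forall A, Sigma k X c' A -> Sigma k X c' (~` A).
Proof.
move=> Nk c1 cc' c'_succ c_dec c_union A Ac'.
have [d [B [dk -> BP]]] := SigmaP Ac' (ole_lt_trans c1 cc').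
have /choice[D DP] : forall i, exists D : {T : Type & T -> set X},
    [/\ embeds (projT1 D) N, ~` B i = \bigcup_t projT2 D t &
      forall t, Sigma k X c (~` projT2 D t)].
  move=> i; have [b [_ bc' Bb]] := BP i.
  have [T [C [TN BC CP]]] := c_dec _ (Sigma_k_mono (c'_succ _ bc') Bb).
  by exists (existT _ T C).
have -> : ~` (\bigcup_i B i) =
    \bigcup_(h : forall i, projT1 (D i)) \bigcap_i projT2 (D i) (h i).
  rewrite setC_bigcup; apply/seteqP; split=> x; last first.
    move=> [h _ hx] i _; have [_ -> _] := DP i.
    by exists (h i) => //; exact: hx.
  move=> Bx; have /dep_choice[h hx] : forall i, exists t, projT2 (D i) t x.
    by move=> i; have := Bx i I; have [_ -> _] := DP i => -[t]; exists t.
  by exists h => // i _.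
apply: Sigma_union => [||h]; first exact: ole_lt_trans cc'.
  apply: small_sized => //.
  apply: small_embeds (small_fun k_sing k_pow (olt_small dk) Nk).
  have /dep_choice[e ei] : forall i, exists e : projT1 (D i) -> N, injective e.
    by move=> i; have [] := DP i.
  exists (fun h i => e i (h i)) => h h' hh'.
  apply: functional_extensionality_dep => i.
  by apply: (ei i); exact: (congr1 (fun u => u i) hh').
exists c; split=> //; rewrite setC_bigcap; apply: c_union => [|i].
  exact: olt_small.
by have [_ _] := DP i; apply.
Qed.

(** From k^+ to [k], a union of length [k] is regrouped into two levels of
    shorter unions. From [k] to k^+, a set of an odd level is the complement of
    a set of that level, so the shorter unions on both levels merge into one of
    length [k]. The second part, with a bound [N] independent of [A], is what
    makes [Sigma_succ_compl] applicable at the next level. *)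
Lemma Sigma_csucc_double (a : Ord) : embeds a k ->
  (forall A, Sigma (csucc k) X (oadd oone a) A <->
             Sigma k X (oadd oone (omul otwo a)) A) /\
  exists2 N : Type, small k N &
    forall A, Sigma (csucc k) X (oadd oone a) A ->
      exists (T : Type) (B : T -> set X), [/\ embeds T N, A = \bigcup_t B t &
        forall t, Sigma k X (oadd oone (omul otwo a)) (~` B t)].
Proof.
elim/(well_founded_ind olt_wf): a => a IH ak.
have [[x0]|a0] := pselect (inhabited a); last first.
  have a_empty : a -> False by move=> x; apply: a0.
  have one_a : oeq (oadd oone a) oone := oadd_empty _ a_empty.
  have one_2a : oeq (oadd oone (omul otwo a)) oone.
    by apply: oadd_empty => -[_ /a_empty].
  split=> [A|].
    split; first by move/(Sigma_oneP _ _ one_a)/(Sigma_oneP k _ one_2a).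
    by move/(Sigma_oneP _ _ one_2a)/(Sigma_oneP (csucc k) _ one_a).
  exists (cof k); first exact: small_cof.
  move=> A /(Sigma_oneP _ _ one_a)/open_cof_union[T [C [Tc AC oC]]].
  by exists T, C; split=> // t; exact/(Sigma_oneP _ _ one_2a).
have a1 := olt_1add_pos x0; have a2 := olt_1double_pos x0.
have one_le b : ole oone (oadd oone b) := ole_addr _ _.
have levelE (x : a) A : Sigma (csucc k) X (oadd oone (oseg x)) A <->
    Sigma k X (oadd oone (omul otwo (oseg x))) A.
  by have [] := IH _ (olt_oseg x) (embeds_trans (oseg_embeds x) ak).
have odd_compl (x : a) A :
    Sigma k X (odd_level x) A -> Sigma k X (odd_level x) (~` A).
  have [_ [N Nk decomp]] :=
    IH _ (olt_oseg x) (embeds_trans (oseg_embeds x) ak).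
  apply: (Sigma_succ_compl Nk (one_le _) (odd_level_gt x)).
  - exact: odd_level_succ.
  - by move=> B /levelE; exact: decomp.
  - move=> T B Tk BP; apply/levelE; apply: Sigma_csucc_union => // [|t].
      exact: small_le.
    exact/levelE.
have decomp : exists2 N : Type, small k N &
    forall A, Sigma (csucc k) X (oadd oone a) A ->
      exists (T : Type) (B : T -> set X), [/\ embeds T N, A = \bigcup_t B t &
        forall t, exists x : a, Sigma k X (odd_level x) (~` B t)].
  have [M [Mk [c c_cof]]] := small_cofinal k_sing ak.
  have [f f_cof] := cof_cofinal k_sing.
  exists (cof k * M)%type; first exact: small_prod (small_cof k_sing) Mk.
  move=> A /SigmaP/(_ a1)[d [B [/olt_csucc[e ei] -> BP]]].
  have /choice[x xP] : forall i, exists x : a,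
      Sigma k X (oadd oone (omul otwo (oseg x))) (~` B i).
    move=> i; have [b [b1 ba Bb]] := BP i.
    have [x bx] := olt_1add ba b1; exists x; apply/levelE.
    exact: Sigma_oeq Bb.
  (* The groups: indices in the segment [f j], with level at most [c m]. *)
  pose G (p : cof k * M) :=
    {i : d | orel (e i) (f p.1) /\ ~ orel (c p.2) (x i)}.
  exists (cof k * M)%type, (fun p => \bigcup_(i : G p) B (proj1_sig i)); split.
  - exact: embeds_refl.
  - apply/seteqP; split=> y; last by move=> [p _ [[i ip] _ Biy]]; exists i.
    move=> [i _ Biy]; have [j ij] := f_cof (e i); have [m im] := c_cof (x i).
    by exists (j, m) => //; exists (exist _ i (conj ij im)).
  - move=> [j m]; exists (c m); apply: odd_compl.
    have gt1 : olt oone (odd_level (c m)).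
      by apply: ole_lt_trans (odd_level_gt _); exact: one_le.
    apply: Sigma_union => // [|[i [/= ij im]]].
      apply: small_sized => //; exists (f j).
      exists (fun i : G (j, m) =>
        exist (fun y => orel y (f j)) (e (proj1_sig i)) (proj2_sig i).1).
      by move=> [i ip] [i' ip'] [/ei ii']; exact: eq_exist.
    exists (oadd oone (omul otwo (oseg (c m)))); split=> //.
      exact: odd_level_gt.
    apply: Sigma_k_mono (xP i).
    apply: ole_trans (or_intror (oeq_sym (oseg_1double _))) _.
    apply: ole_trans _ (or_intror (oseg_1double _)).
    apply/ole_oseg; case: (ole_total_rel im) => [xc|->]; last by right.
    by left; left.
split=> [A|]; last first.
  have [N Nk NP] := decomp; exists N => // A /NP[T [B [TN AB BP]]].
  exists T, B; split=> // t; have [x] := BP t; apply: Sigma_k_mono.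
  by left; exact: odd_level_lt.
split=> [SA|].
  have [N Nk /(_ A SA)[T [B [TN -> BP]]]] := decomp.
  apply: Sigma_union => // [|t].
    by apply: small_sized => //; exact: small_embeds TN Nk.
  have [x Bx] := BP t; exists (odd_level x).
  by split=> //; [exact: Sigma_pos Bx|exact: odd_level_lt].
move=> /SigmaP/(_ a2)[d [B [dk -> BP]]].
apply: Sigma_csucc_union => // [|i]; first exact: small_le (olt_small dk).
have [b [b1 ba Bb]] := BP i; have [x bx] := olt_1double ba b1.
have := odd_compl x _ (Sigma_k_mono bx Bb); rewrite setCK.
move=> /SigmaP[]; first by apply: ole_lt_trans (odd_level_gt _); exact: one_le.
move=> d' [C [d'k -> CP]]; apply: Sigma_union => // [|j].
  by apply: csucc_sized; exact: small_le (olt_small d'k).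
have [b' [_ bx' Cb]] := CP j; exists (oadd oone (oseg x)); split=> //.
  exact: olt_add_oseg.
by apply/levelE; have := Sigma_k_mono (odd_level_succ bx') Cb.
Qed.

(** A union of [k] many sets is a union of [cof k] many shorter unions. *)
Lemma Bor_csucc : Bor (csucc k) X = Bor k X.
Proof.
have [f f_cof] := cof_cofinal k_sing.
have algE (F : set (set X)) : gamma_algebra k F <-> gamma_algebra (csucc k) F.
  split=> -[FC FU]; split=> // d A dg; last first.
    by apply: FU; apply/olt_csucc; exact: small_le (olt_small dg).
  move=> FA.
  have F_union (T : Type) (B : T -> set X) :
      small k T -> (forall t, F (B t)) -> F (\bigcup_t B t).
    move=> Tk FB; have [t [h [h' hK h'K]]] := well_orderable T.
    have -> : \bigcup_t B t = \bigcup_(j : t) B (h' j).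
      apply/seteqP; split=> x [i _ Bx]; last by exists (h' i).
      by exists (h i); rewrite // hK.
    apply: FU => //; apply: (small_sized k_card Tk).
    by exists h'; exact: can_inj h'K.
  have [e ei] : embeds d k by exact/olt_csucc.
  pose G j := {i : d | orel (e i) (f j)}.
  have -> : \bigcup_i A i = \bigcup_j \bigcup_(i : G j) A (proj1_sig i).
    apply/seteqP; split=> x; last by move=> [j _ [[i ij] _ Aix]]; exists i.
    move=> [i _ Aix]; have [j ij] := f_cof (e i).
    by exists j => //; exists (exist _ i ij).
  apply: (F_union) => [|j]; first exact: small_cof.
  apply: (F_union) => //; exists (f j).
  exists (fun i : G j =>
    exist (fun y => orel y (f j)) (e (proj1_sig i)) (proj2_sig i)).
  by move=> [i ip] [i' ip'] [/ei ii']; exact: eq_exist.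
have algE' : @gamma_algebra (csucc k) X = @gamma_algebra k X.
  by apply/funext => F; apply/propext; split=> /algE.
by rewrite /Bor algE'.
Qed.

End TwoHierarchies.

Theorem corollary5p2 (k : Ord) (X : topologicalType)
  (k_sing : singular k)
  (k_pow : oeq (pow2_lt k) k)
  (X_neq0 : [set: X] !=set0)
  (X_reg : @regular_space X)
  (X_haus : hausdorff_space X)
  (X_weight : ole (weight X) k)
  (X_open : Sigma k X oone `<=` Sigma (csucc (cof k)) X otwo) :
  (forall a : Ord, olt a (csucc k) ->
     ole (borel_ord (csucc k) X) (oadd oone a) <->
     ole (borel_ord k X) (oadd oone (omul otwo a)))
  /\
  (forall a : Ord, olimit a ->
     oeq (borel_ord (csucc k) X) a \/ oeq (borel_ord k X) a ->
     oeq (borel_ord (csucc k) X) a /\ oeq (borel_ord k X) a).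
Proof.
have nat_k := nat_le k_sing.
have k_card : is_cardinal k by case: k_sing.
have unit_small : small k unit.
  apply: small_embeds (small_nat k_sing).
  by exists (fun=> 0%N) => -[] [].
have k_le d : olt d k -> embeds d k by move=> /olt_small/small_le.
have kS_le d : olt d (csucc k) -> embeds d k by move=> /olt_csucc.
have ok := open_Sigma2 X_open (cof_sized k_sing).
have okS := open_Sigma2 X_open (cof_csucc_sized k_sing).
have uk : sized k unit := small_sized k_card unit_small.
have ukS : sized (csucc k) unit := csucc_sized (small_le unit_small).
have iff_ord (a : Ord) : olt a (csucc k) ->
    ole (borel_ord (csucc k) X) (oadd oone a) <->
    ole (borel_ord k X) (oadd oone (omul otwo a)).
  move=> /kS_le ak; have [SE _] := Sigma_csucc_double k_sing k_pow X_open ak.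
  rewrite (borel_ord_leP okS nat_k kS_le ukS (ole_addr _ _)).
  rewrite (borel_ord_leP ok nat_k k_le uk (ole_addr _ _)).
  rewrite (Bor_csucc _ k_sing).
  by have -> : Sigma (csucc k) X (oadd oone a) =
    Sigma k X (oadd oone (omul otwo a)) by apply/funext => A; exact/propext.
have kS_max := borel_ord_le_csucc okS nat_k kS_le ukS.
have k_max := borel_ord_le_csucc ok nat_k k_le uk.
split=> // a alim ord_a.
set o1 := borel_ord (csucc k) X in ord_a kS_max iff_ord *.
set o2 := borel_ord k X in ord_a k_max iff_ord *.
have a_le : ole a (csucc k).
  by case: ord_a => /oeq_sym ao;
    [apply: ole_trans kS_max|apply: ole_trans k_max]; right.
have iff_a : ole o1 a <-> ole o2 a.
  case: a_le => [a_lt|aE]; last first.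
    by split=> _; apply: ole_trans (or_intror (oeq_sym aE)).
  split=> oa.
    apply: ole_trans (limit_1double alim); apply/iff_ord => //.
    exact: ole_trans oa (ole_addl _ _).
  apply: ole_trans (limit_1add alim); apply/iff_ord => //.
  apply: ole_trans oa (ole_trans (ole_double _) _); exact: ole_addl.
have y_lt (y : a) : olt (oseg y) (csucc k) := olt_le_trans (olt_oseg y) a_le.
have lt2_lt1 : olt o2 a -> olt o1 a.
  move=> [y o2y]; apply: olt_le_trans (limit_1add alim).
  apply: ole_lt_trans (olt_add_oseg y).
  apply/iff_ord => //; apply: ole_trans (or_intror o2y) _.
  exact: ole_trans (ole_double _) (ole_addl _ _).
have lt1_lt2 : olt o1 a -> olt o2 a.
  move=> [y o1y]; apply: olt_le_trans (limit_1double alim).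
  apply: ole_lt_trans (olt_trans (odd_level_gt y) (odd_level_lt y)).
  apply/iff_ord => //; exact: ole_trans (or_intror o1y) (ole_addl _ _).
case: ord_a => oa; split=> //.
  have /iff_a[/lt2_lt1 o1a|//] : ole o1 a by right.
  by case: (olt_irr (oeq_ltl (oeq_sym oa) o1a)).
have /iff_a[/lt1_lt2 o2a|//] : ole o2 a by right.
by case: (olt_irr (oeq_ltl (oeq_sym oa) o2a)).
Qed.
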